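(* Let $E$ be a uniformly smooth and uniformly convex real Banach space with dual space $E^{*}$ and normalized duality map $J$, and let $C$ be a nonempty closed and convex subset of $E$ such that $JC$ is closed and convex. Let $\{f_i\}_{i=1}^{\infty}$ be a countable family of bifunctions from $JC\times JC$ to $\mathbb{R}$, each satisfying conditions (A1)-(A4) listed in the context; let $\{A_j\}_{j=1}^{\infty}$ be a countable family of continuous monotone mappings from $C$ into $E^{*}$; and let $\{T_n\}_{n=1}^{\infty}$ be a countable family of generalized $J_{*}$-nonexpansive maps from $C$ into $E^{*}$. Let $\Gamma$ be a family of $J_{*}$-closed and generalized $J_{*}$-nonexpansive maps from $C$ into $E^{*}$ such that $$\bigcap_{n=1}^{\infty}F_J(T_n)=F_J(\Gamma)\neq\emptyset .$$ Assume that $\{T_n\}$ satisfies the NST-condition with $\Gamma$, and suppose that the common solution set $$B:=F_J(\Gamma)\cap\Big[\bigcap_{i=1}^{\infty}EP(f_i)\Big]\cap\Big[\bigcap_{j=1}^{\infty}VI(C,A_j)\Big]$$ is nonempty, closed and convex. Let $\mu,\nu:\mathbb{N}\to\mathbb{N}$ be maps such that $\{n:\mu(n)=i\}$ and $\{n:\nu(n)=j\}$ are infinite for all $i,j\in\mathbb{N}$. Let $h:C\to C$ be a contraction with coefficient $\rho\in(0,1)$ and let $\bar u\in C$. Let $\{\lambda_n\},\{\sigma_n\}\subset[0,1)$ satisfy $\lambda_n+\sigma_n<1$ for all $n$, $\lambda_n\to0$ and $\sigma_n\to 0$. Let $\alpha_1,\alpha_2,\alpha_3\in(0,1)$ with $\alpha_1+\alpha_2+\alpha_3=1$,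 and let $\{r_n\}\subset[a,\infty)$ for some $a>0$. Starting from $x_1\in C$ and $C_1=C$, define for all $n\ge1$ $$\begin{aligned} s_n&=J^{-1}\big(\lambda_nJh(x_n)+\sigma_nJ\bar u+(1-\lambda_n-\sigma_n)Jx_n\big),\\ z_n&=\Big\{z\in C: f_{\mu(n)}(Jz,Jy)+\tfrac1{r_n}\langle y-z,Jz-Js_n\rangle\ge0\ \ \forall y\in C\Big\},\\ u_n&=\Big\{z\in C:\langle y-z,A_{\nu(n)}z\rangle+\tfrac1{r_n}\langle y-z,Jz-Js_n\rangle\ge0\ \ \forall y\in C\Big\},\\ y_n&=J^{-1}\big(\alpha_1Js_n+\alpha_2Jz_n+\alpha_3T_nu_n\big),\\ C_{n+1}&=\{v\in C_n:\phi(v,y_n)\le\phi(v,s_n)\},\\ x_{n+1}&=\Pi_{C_{n+1}}x_1 . \end{aligned}$$ Then $$\|s_n-x_n\|\to0,\quad \|y_n-x_{n+1}\|\to0,\quad \|z_n-s_n\|\to0,\quad \|u_n-s_n\|\to0,\quad \|Ju_n-T_nu_n\|\to0 .$$ Consequently $s_n\to\Pi_Bx_1$, $y_n\to\Pi_Bx_1$, $z_n\to\Pi_Bx_1$ and $u_n\to\Pi_Bx_1$ (strongly).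
   Context: Notation. $\langle x,x^{*}\rangle$ is the pairing of $x\in E$ with $x^{*}\in E^{*}$. The normalized duality map is $Jx=\{x^{*}\in E^{*}:\langle x,x^{*}\rangle=\|x\|\|x^{*}\|,\ \|x\|=\|x^{*}\|\}$; for $E$ uniformly smooth and uniformly convex it is a single-valued bijection $E\to E^{*}$, and $J_{*}=J^{-1}:E^{*}\to E$. Lyapunov functional: $\phi(x,y)=\|x\|^2-2\langle x,Jy\rangle+\|y\|^2$ for $x,y\in E$. For a nonempty closed convex $K\subset E$ and $x\in E$, the generalized projection $\Pi_Kx$ is the unique point of $K$ with $\phi(\Pi_Kx,x)=\inf_{y\in K}\phi(y,x)$. $J$-fixed points: for $T:C\to E^{*}$, $F_J(T)=\{p\in C:Tp=Jp\}$; for a family $\Gamma$ of such maps, $F_J(\Gamma)=\bigcap_{T\in\Gamma}F_J(T)$. $T:C\to E^{*}$ is generalized $J_{*}$-nonexpansive if $F_J(T)\ne\emptyset$ and $\phi(p,(J_{*}\circ T)x)\le\phi(p,x)$ for all $x\in C$, $p\in F_J(T)$. $T$ is $J_{*}$-closed if whenever $x_n\to x$ and $(J_{*}\circ T)x_n\to y$ (with $x_n\in C$), then $(J_{*}\circ T)x=y$. NST-condition: given families $\{T_n\}$ and $\Gamma$ of generalized $J_{*}$-nonexpansive maps from $C$ into $E^{*}$ with $\bigcap_nF_J(T_n)=F_J(\Gamma)\ne\emptyset$, $\{T_n\}$ satisfies the NST-condition with $\Gamma$ if for each bounded sequence $\{x_n\}\subset C$, $\|Jx_n-T_nx_n\|\to0$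 implies $\|Jx_n-Tx_n\|\to0$ for all $T\in\Gamma$. Conditions on a bifunction $f:JC\times JC\to\mathbb{R}$: (A1) $f(x^{*},x^{*})=0$ for all $x^{*}\in JC$; (A2) $f(x^{*},y^{*})+f(y^{*},x^{*})\le0$ for all $x^{*},y^{*}\in JC$; (A3) $\limsup_{t\downarrow0}f(tz^{*}+(1-t)x^{*},y^{*})\le f(x^{*},y^{*})$ for all $x^{*},y^{*},z^{*}\in JC$; (A4) for each $x^{*}\in JC$, $f(x^{*},\cdot)$ is convex and lower semicontinuous. Solution sets: $EP(f)=\{x\in C:f(Jx,Jy)\ge0\ \forall y\in C\}$; for $A:C\to E^{*}$, $VI(C,A)=\{x\in C:\langle y-x,Ax\rangle\ge0\ \forall y\in C\}$. $A$ is monotone if $\langle x-y,Ax-Ay\rangle\ge0$ for all $x,y\in C$. Convention: ''$z_n=\{z\in C:\dots\}$'' and ''$u_n=\{z\in C:\dots\}$'' mean that the set on the right is a singleton whose unique element is $z_n$, respectively $u_n$. *)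

(* Defs.v *)
From HB Require Import structures.
From mathcomp Require Import all_boot all_order all_algebra interval_inference.
From mathcomp Require Import all_classical all_reals all_analysis.

Set Implicit Arguments.
Unset Strict Implicit.
Unset Printing Implicit Defensive.

Import Order.TTheory GRing.Theory Num.Theory.
Import numFieldNormedType.Exports.
Local Open Scope classical_set_scope.
Local Open Scope ring_scope.

Section Dual.
Context {R : realType} {E : normedModType R}.

Definition continuous_linear_form : {pred E -> R^o} :=
  mem [set f : E -> R^o | linear f /\ continuous f].

Let continuous_linear_form_submod : subsemimod_closed continuous_linear_form.
Proof.
split; first split.
- rewrite inE; split=> [a x y|x]; first by rewrite scaler0 addr0.
  exact: (@cst_continuous E R^o).
- move=> f g; rewrite !inE => -[lf cf] [lg cg]; split=> [a x y|x].
    have -> (u : E) : (f + g) u = f u + g u by [].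
    by rewrite !fctE lf lg scalerDr addrACA.
  exact: continuousD (cf x) (cg x).
- move=> a f; rewrite !inE => -[lf cf]; split=> [b x y|x].
    have -> (u : E) : (a *: f) u = (a *: f u : R^o) by [].
    by rewrite lf scalerDr !scalerA (mulrC a).
  exact: (@cvgM _ _ _ _ (cst a) (f : E -> R) _ _ (cvg_cst a) (cf x)).
Qed.

HB.instance Definition _ := GRing.isSubmodClosed.Build R (E -> R^o)
  continuous_linear_form continuous_linear_form_submod.

End Dual.

Record dual {R : realType} (E : normedModType R) : Type := Dual {
  dual_fun :> E -> R^o ;
  dual_funP : dual_fun \in continuous_linear_form
}.

Section DualNormed.
Context {R : realType} {E : normedModType R}.

HB.instance Definition _ := [isSub for @dual_fun R E].
HB.instance Definition _ := [Choice of dual E by <:].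
HB.instance Definition _ := [SubChoice_isSubLmodule of dual E by <:].

Definition dual_norm (f : dual E) : R :=
  sup [set `|f x| | x in [set x : E | `|x| <= 1]].

Lemma dual_linear (f : dual E) : linear f.
Proof. by have := dual_funP f; rewrite inE => -[]. Qed.

Lemma dual_continuous (f : dual E) : continuous f.
Proof. by have := dual_funP f; rewrite inE => -[]. Qed.

Let dual_has_sup (f : dual E) :
  has_sup [set `|f x| | x in [set x : E | `|x| <= 1]].
Proof.
split; first by exists `|f 0|, 0 => //=; rewrite normr0.
pose lf := GRing.isLinear.Build R E R^o *:%R f (@dual_linear f).
pose g : {linear E -> R^o} := HB.pack (dual_fun f) lf.
have gc : continuous g by exact: (@dual_continuous f).
have /(linear_bounded_continuous g)/bounded_funP/(_ 1)[M gM] := gc.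
by exists M => _ [x /= x1 <-]; exact: gM.
Qed.

Let dual_norm_ub (f : dual E) (x : E) : `|x| <= 1 -> `|f x| <= dual_norm f.
Proof. by move=> x1; apply: (ub_le_sup (dual_has_sup f).2); exists x. Qed.

Let dual_norm_le (f : dual E) (M : R) :
  (forall x, `|x| <= 1 -> `|f x| <= M) -> dual_norm f <= M.
Proof.
move=> fM; apply: ge_sup; first exact: (dual_has_sup f).1.
by move=> _ [x /= x1 <-]; exact: fM.
Qed.

Let dual_ler_normD (f g : dual E) :
  dual_norm (f + g) <= dual_norm f + dual_norm g.
Proof.
apply: dual_norm_le => x x1; have -> : (f + g : dual E) x = f x + g x by [].
by rewrite (le_trans (ler_normD _ _))// lerD// dual_norm_ub.
Qed.

Let dual_normrZ_le (a : R) (f : dual E) :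
  dual_norm (a *: f) <= `|a| * dual_norm f.
Proof.
apply: dual_norm_le => x x1; have -> : (a *: f : dual E) x = a * f x by [].
by rewrite normrM ler_wpM2l// dual_norm_ub.
Qed.

Let dual_norm_ge0 (f : dual E) : 0 <= dual_norm f.
Proof.
by apply: (@le_trans _ _ `|f 0|) => //; rewrite dual_norm_ub// normr0.
Qed.

Let dual_normrZ (a : R) (f : dual E) :
  dual_norm (a *: f) = `|a| * dual_norm f.
Proof.
apply/eqP; rewrite eq_le dual_normrZ_le/=.
have [->|a0] := eqVneq a 0; first by rewrite normr0 mul0r dual_norm_ge0.
rewrite mulrC -ler_pdivlMr ?normr_gt0// mulrC -normfV.
by have := dual_normrZ_le a^-1 (a *: f); rewrite scalerA mulVf// scale1r.
Qed.

Let dual_normr0_eq0 (f : dual E) : dual_norm f = 0 -> f = 0.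
Proof.
move=> f0; apply: val_inj; apply/funext => x /=.
have fZ (a : R) (u : E) : f (a *: u) = a * f u.
  have f00 : f 0 = 0.
    by have := dual_linear f (-1) 0 0; rewrite scaler0 addr0 scaleN1r addNr.
  by have := dual_linear f a u 0; rewrite !addr0 f00 addr0.
have [->|x0] := eqVneq x 0; first by have := fZ 0 0; rewrite scale0r mul0r.
have : `|f (`|x|^-1 *: x)| <= 0.
  by rewrite -f0 dual_norm_ub// normrZ normfV normr_id mulVf// normr_eq0.
rewrite fZ normr_le0 mulf_eq0 invr_eq0 normr_eq0 (negbTE x0)/=.
by move/eqP.
Qed.

HB.instance Definition _ := Lmodule_isNormed.Build R (dual E)
  dual_ler_normD dual_normrZ dual_normr0_eq0.

Lemma dual_normE (f : dual E) : `|f| = dual_norm f.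
Proof. by []. Qed.

End DualNormed.

Section Geometry.
Context {R : realType} (E : normedModType R).

Definition uniformly_convex : Prop :=
  forall e : R, 0 < e <= 2 -> exists2 d : R, 0 < d &
    forall x y : E, `|x| = 1 -> `|y| = 1 -> e <= `|x - y| ->
      `|2^-1 *: (x + y)| <= 1 - d.

Definition modulus_of_smoothness (t : R) : R :=
  sup [set r | exists x y : E,
    [/\ `|x| = 1, `|y| = t & r = (`|x + y| + `|x - y|) / 2 - 1]].

Definition uniformly_smooth : Prop :=
  modulus_of_smoothness t / t @[t --> 0^'+] --> (0 : R).

End Geometry.

(* The pairing <x, xs> of x in E with xs in E* is the application xs x. *)
Section DualityMap.
Context {R : realType} {E : normedModType R}.
Implicit Types (x y : E) (xs : dual E) (C K : set E) (T A : E -> dual E).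

Definition duality_set x : set (dual E) :=
  [set xs : dual E | xs x = `|x| * `|xs| /\ `|x| = `|xs|].

(* xget 0 P is an element of P if there is one, and 0 otherwise. For E complete,
   uniformly smooth and uniformly convex, every duality_set x is a singleton,
   J is a bijection from E to dual E, and the generalized projection on a
   nonempty closed convex set exists and is unique, so that each use of xget
   below selects the intended unique point. *)
Definition J x : dual E := xget 0 (duality_set x).

Definition Jinv xs : E := xget 0 [set x | J x = xs].

Definition phi x y : R := `|x| ^+ 2 - 2 * J y x + `|y| ^+ 2.

Definition is_gen_proj K x p : Prop :=
  K p /\ phi p x = inf [set phi y x | y in K].

Definition gen_proj K x : E := xget 0 [set p | is_gen_proj K x p].

(* A map from C to E* is represented by a total function E -> dual E, and a
   bifunction on JC x JC by a total function of two arguments in dual E; only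
   their values on C, respectively on JC, matter below. *)

Definition FJ C T : set E := [set p | C p /\ T p = J p].

Definition FJ_family C (Gamma : set (E -> dual E)) : set E :=
  \bigcap_(T in Gamma) FJ C T.

Definition gen_Jstar_nonexpansive C T : Prop :=
  FJ C T !=set0 /\
  forall x p, C x -> FJ C T p -> phi p (Jinv (T x)) <= phi p x.

Definition Jstar_closed C T : Prop :=
  forall (u : nat -> E) (x y : E), (forall n, C (u n)) ->
    u @ \oo --> x -> Jinv (T (u n)) @[n --> \oo] --> y -> Jinv (T x) = y.

Definition NST_condition C (T : nat -> E -> dual E)
    (Gamma : set (E -> dual E)) : Prop :=
  forall u : nat -> E, (forall n, C (u n)) -> bounded_fun u ->
    `|J (u n) - T n (u n)| @[n --> \oo] --> (0 : R) ->
    forall S, Gamma S -> `|J (u n) - S (u n)| @[n --> \oo] --> (0 : R).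

Definition monotone_on C A : Prop :=
  forall x y, C x -> C y -> 0 <= (A x - A y) (x - y).

Definition EP C (f : dual E -> dual E -> R) : set E :=
  [set x | C x /\ forall y, C y -> 0 <= f (J x) (J y)].

Definition VI C A : set E :=
  [set x | C x /\ forall y, C y -> 0 <= A x (y - x)].

End DualityMap.

Section Bifunction.
Context {R : realType} {X : normedModType R}.
Variables (D : set X) (f : X -> X -> R).

Definition condA1 : Prop := forall x, D x -> f x x = 0.

Definition condA2 : Prop := forall x y, D x -> D y -> f x y + f y x <= 0.

Definition condA3 : Prop := forall x y z, D x -> D y -> D z ->
  (limf_esup (fun t : R => (f (t *: z + (1 - t) *: x) y)%:E) 0^'+
     <= (f x y)%:E)%E.

(* Lower semicontinuity is relative to D: in the topology of subspace D, the
   points of D have their relative neighborhoods and the other points are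
   isolated. *)
Definition condA4 : Prop := forall x, D x ->
  convex_function D (f x) /\
  lower_semicontinuous ((fun y => (f x y)%:E) : subspace D -> \bar R).

Definition equilibrium_bifunction : Prop :=
  [/\ condA1, condA2, condA3 & condA4].

End Bifunction.

(* Main.v *)
Require Import Defs.
From HB Require Import structures.
From mathcomp Require Import all_boot all_order all_algebra interval_inference.
From mathcomp Require Import all_classical all_reals all_analysis.
From mathcomp Require Import ring lra.

Set Implicit Arguments.
Unset Strict Implicit.
Unset Printing Implicit Defensive.

Import Order.TTheory GRing.Theory Num.Theory.
Import numFieldNormedType.Exports.
Local Open Scope classical_set_scope.
Local Open Scope ring_scope.

(* Write p for the limit of the x_n. The points of B lie in every C_n, and x_n
   minimizes phi(., x_1) over C_n, so the values phi(x_n, x_1) increase to a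
   finite limit; as C_n is convex, uniform convexity of the squared norm on
   bounded sets makes (x_n) a Cauchy sequence. J is continuous (uniform
   smoothness), and J w_n -> J p implies w_n -> p (uniform convexity), whence
   s_n -> p, and y_n -> p since phi(x_(n+1), y_n) <= phi(x_(n+1), s_n).
   For q in B, the resolvent inequality phi(q, z) + phi(z, s) <= phi(q, s) for
   z_n and u_n and convexity of the squared dual norm give
     alpha2 phi(z_n, s_n) + alpha3 phi(u_n, s_n) <= phi(q, s_n) - phi(q, y_n),
   so z_n and u_n tend to p. Solving the definition of y_n for T_n u_n then
   yields T_n u_n -> J p directly, without any uniform convexity of the dual.
   Finally p belongs to B and minimizes phi(., x_1) over B. *)

(** * Limits expressed through distances *)

Lemma cvg_dist0 {R : realType} {V : normedModType R} (T : Type)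
    (F : set_system T) {FF : Filter F} (u v : T -> V) (l : V) :
  u @ F --> l -> v @ F --> l -> `|u t - v t| @[t --> F] --> (0 : R).
Proof.
move=> ul vl; have /cvg_norm : u t - v t @[t --> F] --> l - l by exact: cvgB.
by rewrite subrr normr0.
Qed.

Lemma cvg_from_dist0 {R : realType} {V : normedModType R} (u v : nat -> V)
    (l : V) :
  v @ \oo --> l -> `|u n - v n| @[n --> \oo] --> (0 : R) -> u @ \oo --> l.
Proof.
move=> vl /norm_cvg0 uv.
have -> : u = (fun n => (u n - v n) + v n) by apply/funext => n; rewrite subrK.
by rewrite -[l]add0r; apply: cvgD.
Qed.

(** * Bounded functionals: norm estimates and the pairing *)

Section DualTheory.
Context {R : realType} {E : normedModType R}.
Implicit Types (f g : dual E) (x y : E).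

Let dual_zero f : f 0 = 0.
Proof.
by have := dual_linear f (-1) 0 0; rewrite scaler0 addr0 scaleN1r addNr.
Qed.

Lemma dual_appD f x y : f (x + y) = (f x : R) + f y.
Proof. by have := dual_linear f 1 x y; rewrite !scale1r. Qed.

Lemma dual_appZ f (a : R) x : f (a *: x) = a * (f x : R).
Proof. by have := dual_linear f a x 0; rewrite !addr0 dual_zero addr0. Qed.

Lemma dual_appB f x y : f (x - y) = (f x : R) - f y.
Proof. by rewrite dual_appD -scaleN1r dual_appZ mulN1r. Qed.

Lemma dual_funD f g x : (f + g) x = (f x : R) + g x. Proof. by []. Qed.

Lemma dual_funZ (a : R) f x : (a *: f) x = a * (f x : R). Proof. by []. Qed.

Lemma dual_funB f g x : (f - g) x = (f x : R) - g x. Proof. by []. Qed.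

Lemma ler_dual_app f x : `|f x| <= `|f| * `|x|.
Proof.
have [->|x0] := eqVneq x 0; first by rewrite dual_zero !normr0 mulr0.
have -> : `|f x| = `|f (`|x|^-1 *: x)| * `|x|.
  rewrite dual_appZ (normrM (`|x|^-1 : R)) normfV normr_id mulrC mulrA.
  by rewrite mulfV ?mul1r// normr_eq0.
rewrite ler_wpM2r// dual_normE; apply: ub_le_sup; last first.
  exists (`|x|^-1 *: x) => //=.
  by rewrite normrZ normfV normr_id mulVf// normr_eq0.
pose lf := GRing.isLinear.Build R E R^o *:%R f (@dual_linear _ _ f).
pose h : {linear E -> R^o} := HB.pack (dual_fun f) lf.
have hc : continuous h by exact: (@dual_continuous _ _ f).
have /(linear_bounded_continuous h)/bounded_funP/(_ 1)[M hM] := hc.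
by exists M => _ [v /= v1 <-]; exact: hM.
Qed.

Lemma dual_app_le f x : (f x : R) <= `|f| * `|x|.
Proof. exact: le_trans (ler_norm _) (ler_dual_app f x). Qed.

(** Scaling reduces the unit ball to the unit sphere, and replacing x by -x turns the one-sided
    bound into a bound on absolute values. *)
Lemma dual_norm_le_unit f (M : R) :
  0 <= M -> (forall y, `|y| = 1 -> f y <= M :> R) -> `|f| <= M.
Proof.
move=> M0 fM; rewrite dual_normE; apply: ge_sup.
  by exists `|f 0|, 0 => //=; rewrite normr0.
have H x : `|x| <= 1 -> f x <= M :> R.
  have [->|x0 x1] := eqVneq x 0; first by rewrite dual_zero.
  have := fM (`|x|^-1 *: x); rewrite dual_appZ.
  rewrite normrZ normfV normr_id mulVf ?normr_eq0// => /(_ erefl).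
  rewrite mulrC ler_pdivrMr ?normr_gt0// => /le_trans; apply.
  by rewrite ler_piMr.
move=> _ [x /= x1 <-]; rewrite ler_norml H// lerNl -mulN1r -dual_appZ.
by rewrite H// scaleN1r normrN.
Qed.

(** Joint continuity of the pairing, from the splitting f x - g u = f (x - u) + (f - g) u, where u
    stays bounded near its limit. *)
Lemma cvg_dual_app (T : Type) (F : set_system T) {FF : Filter F}
    (g : T -> dual E) (u : T -> E) (f : dual E) (x : E) :
  g @ F --> f -> u @ F --> x -> g t (u t) @[t --> F] --> (f x : R).
Proof.
move=> gf ux.
have H t : `|f x - g t (u t)| <=
    `|f| * `|x - u t| + `|f - g t| * (`|x| + `|x - u t|).
  have -> : f x - g t (u t) = f (x - u t) + (f - g t) (u t).
    by rewrite dual_appB dual_funB addrA subrK.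
  apply: le_trans (ler_normD _ _) _; apply: lerD; first exact: ler_dual_app.
  apply: le_trans (ler_dual_app _ _) _; apply: ler_wpM2l => //.
  by rewrite -[X in `|X| <= _](subKr x) (le_trans (ler_normB _ _)).
have ux0 : `|x - u t| @[t --> F] --> (0 : R).
  by apply: cvg_dist0 ux; exact: cvg_cst.
have gf0 : `|f - g t| @[t --> F] --> (0 : R).
  by apply: cvg_dist0 gf; exact: cvg_cst.
have B0 : `|f| * `|x - u t| + `|f - g t| * (`|x| + `|x - u t|) @[t --> F]
    --> (0 : R).
  have -> : (0 : R) = `|f| * 0 + 0 * (`|x| + 0) by rewrite mulr0 mul0r addr0.
  apply: cvgD; first by apply: cvgM => //; exact: cvg_cst.
  by apply: cvgM => //; apply: cvgD => //; exact: cvg_cst.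
apply/cvgrPdist_lt => e e0.
near=> t; apply: le_lt_trans (H t) _.
near: t; have /cvgr_lt := B0; exact.
Unshelve. all: by end_near. Qed.

End DualTheory.

(** * Uniform convexity of the squared norm on bounded sets *)

Section UniformConvexity.
Context {R : realType} {E : normedModType R}.

(* Defect of midpoint convexity of the squared norm. *)
Definition gap (a b : E) : R :=
  (`|a| ^+ 2 + `|b| ^+ 2) / 2 - `|2^-1 *: (a + b)| ^+ 2.

Lemma gapC a b : gap a b = gap b a.
Proof. by rewrite /gap [a + b]addrC [X in X / 2]addrC. Qed.

Lemma normD_half (a b : E) : `|a + b| = 2 * `|2^-1 *: (a + b)|.
Proof. by rewrite normrZ ger0_norm ?invr_ge0// mulrA mulfV ?mul1r. Qed.

Hypothesis hconvex : uniformly_convex E.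

(** Two cases, with a of larger norm. If the norms differ by at least e/4, the gap is at least a
    quarter of the square of that difference. Otherwise the directions of a and b are well
    separated, and uniform convexity on the unit sphere shortens the midpoint. *)
Lemma gap_lower_bound (M e : R) : 0 < M -> 0 < e -> exists2 d : R, 0 < d &
  forall a b : E, `|a| <= M -> `|b| <= M -> e <= `|a - b| -> d <= gap a b.
Proof.
move=> M0 e0.
(* Separation of the unit directions when the norms differ by less than e/4: then at least 3e/4 of
   the distance comes from [|b| * |e1 - e2|] with [|b| <= M]. The cap 2 meets the range required by
   [uniformly_convex]. *)
pose k := Num.min 2 ((3 / 4) * e / M).
have k02 : 0 < k <= 2.
  by rewrite /k lt_min ge_min lexx andbT ltr0n/= divr_gt0// mulr_gt0// divr_gt0.
have [d d0 Hd] := hconvex k02.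
(* The cap 1 keeps 1 - c nonnegative, so the bound on the midpoint may be squared, and gives c^2 <=
   c at the end. *)
pose c := Num.min d 1.
have c0 : 0 < c by rewrite /c lt_min d0/=.
have c1 : c <= 1 by rewrite /c ge_min lexx orbT.
have cd : c <= d by rewrite /c ge_min lexx.
exists (Num.min (e ^+ 2 / 64) (c * (e ^+ 2 / 8))).
  by rewrite lt_min !(mulr_gt0, divr_gt0, exprn_gt0).
move=> a b.
wlog ba : a b / `|b| <= `|a|.
  move=> H aM bM eab; have [ba|/ltW ab] := leP `|b| `|a|; first exact: H.
  by rewrite gapC; apply: H => //; rewrite distrC.
move=> aM bM eab.
have tri : `|2^-1 *: (a + b)| <= (`|a| + `|b|) / 2.
  have := ler_normD a b; rewrite normD_half; lra.
have m0 := normr_ge0 (2^-1 *: (a + b)).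
have b0 := normr_ge0 b.
rewrite ge_min; apply/orP.
have [far|near] := leP (e / 4) (`|a| - `|b|); [left|right].
  have : (`|a| - `|b|) ^+ 2 >= (e / 4) ^+ 2.
    by rewrite ler_sqr ?nnegrE; lra.
  have : `|2^-1 *: (a + b)| ^+ 2 <= ((`|a| + `|b|) / 2) ^+ 2.
    by rewrite ler_sqr ?nnegrE; lra.
  rewrite /gap; lra.
have ea : e <= `|a| + `|b| by apply: le_trans eab (ler_normB _ _).
have bpos : 0 < `|b| by lra.
have apos : 0 < `|a| by lra.
pose e1 := `|a|^-1 *: a; pose e2 := `|b|^-1 *: b.
have aE : a = `|a| *: e1 by rewrite scalerA mulfV ?scale1r// gt_eqF.
have bE : b = `|b| *: e2 by rewrite scalerA mulfV ?scale1r// gt_eqF.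
have n1 : `|e1| = 1 by rewrite normrZ normfV normr_id mulVf// gt_eqF.
have n2 : `|e2| = 1 by rewrite normrZ normfV normr_id mulVf// gt_eqF.
clearbody e1 e2.
have abm : a - b = `|b| *: (e1 - e2) + (`|a| - `|b|) *: e1.
  by rewrite {1}aE {1}bE scalerBr scalerBl [RHS]addrC addrA subrK.
have abp : a + b = `|b| *: (e1 + e2) + (`|a| - `|b|) *: e1.
  by rewrite {1}aE {1}bE scalerDr scalerBl [RHS]addrC addrA subrK.
have ke : k <= `|e1 - e2|.
  rewrite /k ge_min; apply/orP; right; rewrite ler_pdivrMr//.
  have : `|a - b| <= `|b| * `|e1 - e2| + (`|a| - `|b|).
    rewrite abm (le_trans (ler_normD _ _))// !normrZ normr_id n1 mulr1 lerD//.
    by rewrite ger0_norm// subr_ge0.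
  have : `|b| * `|e1 - e2| <= M * `|e1 - e2| by rewrite ler_wpM2r.
  lra.
have mle : `|2^-1 *: (a + b)| <= `|b| * (1 - c) + (`|a| - `|b|) / 2.
  rewrite abp scalerDr (le_trans (ler_normD _ _))// lerD//.
    rewrite scalerA mulrC -scalerA normrZ normr_id ler_wpM2l//.
    by apply: le_trans (Hd _ _ n1 n2 ke) _; lra.
  by rewrite !normrZ n1 mulr1 mulrC !ger0_norm ?subr_ge0.
have sq : `|2^-1 *: (a + b)| ^+ 2 <= (`|b| * (1 - c) + (`|a| - `|b|) / 2) ^+ 2.
  by rewrite ler_sqr ?nnegrE ?addr_ge0 ?mulr_ge0 ?subr_ge0.
have bb : e ^+ 2 / 8 <= `|b| ^+ 2.
  have : (3 / 8 * e) ^+ 2 <= `|b| ^+ 2.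
    by rewrite ler_sqr ?nnegrE//; lra.
  have := sqr_ge0 e; lra.
have cb : c * (e ^+ 2 / 8) <= c * `|b| ^+ 2 by rewrite ler_pM2l.
apply: le_trans cb _.
have : c ^+ 2 * `|b| ^+ 2 <= c * `|b| ^+ 2.
  by rewrite ler_wpM2r ?sqr_ge0// expr2 ler_piMl// ltW.
have : c * `|b| * `|b| <= c * `|b| * `|a| by rewrite ler_wpM2l// mulr_ge0// ltW.
rewrite /gap; nra.
Qed.

(** Contrapositive of [gap_lower_bound], with the radius enlarged to [|M| + 1] to be positive. *)
Lemma gap_small (M e : R) : 0 < e -> exists2 d : R, 0 < d &
  forall a b : E, `|a| <= M -> `|b| <= M -> gap a b < d -> `|a - b| < e.
Proof.
move=> e0; have M0 : 0 < `|M| + 1 by rewrite ltr_wpDl.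
have [d d0 Hd] := gap_lower_bound M0 e0; exists d => // a b aM bM gd.
rewrite ltNge; apply/negP => eab.
have le N : N <= M -> N <= `|M| + 1.
  by move=> NM; rewrite (le_trans NM)// (le_trans (ler_norm M))// lerDl.
by have := Hd a b (le _ aM) (le _ bM) eab; rewrite leNgt gd.
Qed.

(** The bound on the difference of norms puts [b n] eventually in the ball of radius M + 1, so that
    [gap_small] applies to both sequences. *)
Lemma gap_cvg0 (M : R) (a b : nat -> E) (c : nat -> R) :
  (forall n, `|a n| <= M) -> c @ \oo --> (0 : R) ->
  (forall n, (`|a n| - `|b n|) ^+ 2 <= c n) ->
  (forall n, gap (a n) (b n) <= c n) ->
  `|a n - b n| @[n --> \oo] --> (0 : R).
Proof.
move=> aM c0 sq gp; apply/cvgrPdist_lt => e e0.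
have [d d0 Hd] := gap_small (M + 1) e0.
near=> n; rewrite sub0r normrN normr_id; apply: Hd.
- by rewrite (le_trans (aM n))// lerDl.
- have c1 : c n < 1 by near: n; exact: cvgr_lt c0 _ ltr01.
  rewrite leNgt; apply/negP => bM.
  have : 1 ^+ 2 < (`|b n| - `|a n|) ^+ 2.
    by have an := aM n; rewrite ltr_sqr ?nnegrE//; lra.
  have := sq n; nra.
- apply: le_lt_trans (gp n) _; near: n; exact: cvgr_lt c0 _ d0.
Unshelve. all: by end_near. Qed.

End UniformConvexity.

(** Strict convexity: [gap_small] is applied with e equal to [|a - b|] itself. *)
Lemma gap_le0_eq {R : realType} {E : normedModType R} (a b : E) :
  uniformly_convex E -> gap a b <= 0 -> a = b.
Proof.
move=> hconvex g0; apply/eqP; rewrite -subr_eq0 -normr_eq0 eq_le normr_ge0 andbT.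
rewrite leNgt; apply/negP => e0.
have [d d0 Hd] := gap_small hconvex (Num.max `|a| `|b|) e0.
suff: `|a - b| < `|a - b| by rewrite ltxx.
by apply: Hd; rewrite ?le_max ?lexx ?orbT// (le_lt_trans g0).
Qed.

(** Serves both for minimizing sequences and for the iterates of the scheme. *)
Lemma gap_cauchy {R : realType} {E : completeNormedModType R} (M : R)
    (a : nat -> E) (eps : nat -> R) :
  uniformly_convex E -> (forall n, `|a n| <= M) -> eps @ \oo --> (0 : R) ->
  (forall n m, (n <= m)%N -> gap (a n) (a m) <= eps n) -> cvg (a @ \oo).
Proof.
move=> hconvex aM eps0 H; apply/cauchy_cvgP/cauchy_exP => e e0.
have [d d0 Hd] := gap_small hconvex M e0.
have [N _ HN] := cvgr_lt _ eps0 _ d0.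
exists (a N); exists N => // m /= Nm; rewrite -ball_normE /=.
by apply: Hd => //; apply: le_lt_trans (H _ _ Nm) (HN _ _); rewrite /= leqnn.
Qed.

(** The minimization arguments compare two points of a set only with their midpoint. *)
Definition midconvex {R : realType} {E : normedModType R} (K : set E) : Prop :=
  forall a b, K a -> K b -> K (2^-1 *: (a + b)).

Lemma convex_set_conv {R : realType} {E : normedModType R} (K : set E) (t : R) a b :
  convex_set K -> 0 <= t <= 1 -> K a -> K b -> K (t *: a + (1 - t) *: b).
Proof.
move=> cK /andP[t0 t1] /mem_set Ka /mem_set Kb.
by have := cK a b (Itv01 t0 t1) Ka Kb; rewrite inE.
Qed.

Lemma convex_set_midconvex {R : realType} {E : normedModType R} (K : set E) :
  convex_set K -> midconvex K.
Proof.
move=> cK a b Ka Kb; rewrite scalerDr.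
rewrite [X in _ + X *: _](_ : _ = 1 - 2^-1); last by field.
by apply: convex_set_conv => //; rewrite invr_ge0 ler0n invf_le1 ?ler1n.
Qed.

(** * Minimizing the squared norm minus a linear functional *)

Section Energy.
Context {R : realType} {E : normedModType R}.

(* For [f = J w] this is [phi y w - `|w| ^+ 2]. *)
Definition energy (f : dual E) (y : E) : R := `|y| ^+ 2 - 2 * (f y : R).

(** The linear part of the energy has no midpoint defect. *)
Lemma gap_energy f (a b : E) :
  gap a b = (energy f a + energy f b) / 2 - energy f (2^-1 *: (a + b)).
Proof. by rewrite /gap /energy dual_appZ dual_appD; field. Qed.

Lemma energy_norm_sq f (a : E) : (`|a| - `|f|) ^+ 2 <= energy f a + `|f| ^+ 2.
Proof. rewrite /energy; have := dual_app_le f a; lra. Qed.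

Lemma energy_bounded f (m : R) :
  exists M : R, forall a : E, energy f a <= m -> `|a| <= M.
Proof.
(* With k the inner bracket, k >= 1 gives k^2 >= k > m + [|f|^2], so a larger norm would contradict
   [energy_norm_sq]. *)
exists (`|f| + (`|m| + `|f| ^+ 2 + 1)) => a am.
rewrite leNgt; apply/negP => H.
have k0 : 0 <= `|m| + `|f| ^+ 2 + 1 by rewrite !addr_ge0 ?sqr_ge0.
have : (`|m| + `|f| ^+ 2 + 1) ^+ 2 < (`|a| - `|f|) ^+ 2.
  by rewrite ltr_sqr ?nnegrE//; lra.
have := energy_norm_sq f a; have := ler_norm m; have := sqr_ge0 `|f|.
have := normr_ge0 m; nra.
Qed.

Lemma cvg_energy f (u : nat -> E) (p : E) :
  u @ \oo --> p -> energy f (u n) @[n --> \oo] --> energy f p.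
Proof.
move=> up; apply: cvgB; first by apply: cvgM; exact: cvg_norm.
by apply: cvgM; [exact: cvg_cst|apply: cvg_dual_app => //; exact: cvg_cst].
Qed.

Lemma energy_min_uniq (K : set E) f (p q : E) : uniformly_convex E ->
  midconvex K -> K p -> K q -> (forall y, K y -> energy f p <= energy f y) ->
  (forall y, K y -> energy f q <= energy f y) -> p = q.
Proof.
move=> hconvex mK Kp Kq mp mq; apply: gap_le0_eq => //.
rewrite (gap_energy f); have Km := mK _ _ Kp Kq.
have := mp _ Km; have := mq _ Km; lra.
Qed.

End Energy.

(** Midpoints of a minimizing sequence have energy at least the infimum, so the gaps are bounded by
    the errors and the sequence is Cauchy. Completeness thus takes the place of weak compactness. *)
Lemma energy_min_ex {R : realType} {E : completeNormedModType R} (K : set E)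
    (f : dual E) : uniformly_convex E -> K !=set0 -> closed K -> midconvex K ->
  exists2 p, K p & forall y, K y -> energy f p <= energy f y.
Proof.
move=> hconvex [k0 Kk0] cK mK.
pose S := [set energy f y | y in K].
have lS : has_lbound S.
  exists (- `|f| ^+ 2) => _ [y _ <-].
  by have := energy_norm_sq f y; have := sqr_ge0 (`|y| - `|f|); lra.
have iS : has_inf S by split => //; exists (energy f k0), k0.
have infS y : K y -> inf S <= energy f y.
  by move=> Ky; apply: ge_inf => //; exists y.
have ex n : exists y, K y /\ energy f y < inf S + harmonic n.
  have n0 : 0 < harmonic n :> R by rewrite /= invr_gt0.
  have [_ [y Ky <-] lt] := inf_adherent n0 iS.
  by exists y.
have [a Ha] := choice ex.
have Ka n : K (a n) by case: (Ha n).
have [M HM] := energy_bounded f (inf S + 1).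
have aM n : `|a n| <= M.
  apply: HM; apply/ltW/(lt_le_trans (Ha n).2); rewrite lerD2l.
  by rewrite invf_le1// ler1n.
have /(gap_cauchy hconvex aM cvg_harmonic) ca : forall n m, (n <= m)%N ->
    gap (a n) (a m) <= harmonic n.
  move=> n m nm; rewrite (gap_energy f).
  have := infS _ (mK _ _ (Ka n) (Ka m)).
  have : harmonic m <= harmonic n :> R by rewrite lef_pV2 ?posrE// ler_nat.
  have := (Ha n).2; have := (Ha m).2; lra.
exists (lim (a @ \oo)).
  by apply: (closed_cvg K cK _ _ ca); exact: nearW.
move=> y Ky; apply: le_trans (infS _ Ky).
have lime := cvg_energy (f := f) ca.
have limi : inf S + harmonic n @[n --> \oo] --> inf S.
  rewrite -[X in _ --> X]addr0.
  by apply: cvgD; [exact: cvg_cst|exact: cvg_harmonic].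
by apply: (ler_cvg_to lime limi); apply: nearW => n; exact/ltW/(Ha n).2.
Qed.

(** * Derivative of the norm and existence of duality functionals *)

Section DirectionalDerivative.
Context {R : realType} {E : normedModType R}.
Hypothesis hsmooth : uniformly_smooth E.

(** A step t whose modulus of smoothness is below (e/2) t works at the unit vector x / [|x|];
    multiplying by [|x|] carries the estimate to x, with step t [|x|]. *)
Lemma smooth_direction (x : E) (e : R) : x != 0 -> 0 < e -> exists2 t : R, 0 < t &
  forall y, `|y| = 1 -> `|x + t *: y| + `|x - t *: y| <= 2 * `|x| + e * t.
Proof.
move=> x0 e0; have xpos : 0 < `|x| by rewrite normr_gt0.
have e20 : 0 < e / 2 by rewrite divr_gt0.
near (0 : R)^'+ => t; have t0 : 0 < t by [].
have tm : modulus_of_smoothness E t < e / 2 * t.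
  rewrite -ltr_pdivrMr//; near: t.
  exact: cvgr_lt (hsmooth : _ --> (0 : R)) _ e20.
exists (t * `|x|); first exact: mulr_gt0.
move=> y y1; pose x1 := `|x|^-1 *: x.
have xE : x = `|x| *: x1 by rewrite scalerA mulfV ?scale1r// gt_eqF.
have n1 : `|x1| = 1 by rewrite normrZ normfV normr_id mulVf// gt_eqF.
clearbody x1.
have : (`|x1 + t *: y| + `|x1 - t *: y|) / 2 - 1 <= modulus_of_smoothness E t.
  apply: ub_le_sup; last first.
    by exists x1, (t *: y); rewrite normrZ y1 mulr1 gtr0_norm.
  exists t => _ [u [v [u1 vt ->]]].
  have := ler_normD u v; have := ler_normB u v; rewrite u1 vt; lra.
have -> : x + (t * `|x|) *: y = `|x| *: (x1 + t *: y).
  by rewrite scalerDr -xE scalerA [t * _]mulrC.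
have -> : x - (t * `|x|) *: y = `|x| *: (x1 - t *: y).
  by rewrite scalerBr -xE scalerA [t * _]mulrC.
rewrite !normrZ !normr_id => H.
have : `|x1 + t *: y| + `|x1 - t *: y| <= 2 + e * t by lra.
rewrite -(ler_pM2l xpos); lra.
Unshelve. all: by end_near. Qed.

Variable x : E.
Hypothesis x0 : x != 0.

Let Q (t : R) (y : E) : R := (`|x + t *: y| - `|x|) / t.

(** The difference quotients of the convex norm decrease as t decreases to 0, so this infimum is the
    one-sided directional derivative at [x]. *)
Let g (y : E) : R := inf [set Q t y | t in [set t | 0 < t]].

Let Q_ge t y : 0 < t -> - `|y| <= Q t y.
Proof.
move=> t0; rewrite /Q ler_pdivlMr//.
have := ler_normB (x + t *: y) (t *: y).
rewrite addrK [`|t *: y|]normrZ gtr0_norm//.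
lra.
Qed.

Let Q_lb y : has_lbound [set Q t y | t in [set t | 0 < t]].
Proof. by exists (- `|y|) => _ [t /= t0 <-]; exact: Q_ge. Qed.

Let g_le t y : 0 < t -> g y <= Q t y.
Proof. by move=> t0; apply: ge_inf => //; exists t. Qed.

Let g_ge y (m : R) : (forall t, 0 < t -> m <= Q t y) -> m <= g y.
Proof.
move=> H; apply: lb_le_inf; first by exists (Q 1 y), 1 => /=.
by move=> _ [t /= t0 <-]; exact: H.
Qed.

(** For steps t and s, the common step k = ts/(t+s) makes x + k(y+z) a convex combination of x + ty
    and x + sz. *)
Let g_sub y z : g (y + z) <= g y + g z.
Proof.
rewrite -lerBlDr; apply: g_ge => t t0; rewrite lerBlDr -lerBlDl.
apply: g_ge => s s0; rewrite lerBlDl.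
have ts : 0 < t + s by rewrite addr_gt0.
have tsn : t + s != 0 by rewrite gt_eqF.
have tn : t != 0 by rewrite gt_eqF.
have sn : s != 0 by rewrite gt_eqF.
pose k := t * s / (t + s).
have k0 : 0 < k by rewrite divr_gt0// mulr_gt0.
apply: le_trans (g_le _ k0) _.
rewrite /Q ler_pdivrMr//.
have -> : x + k *: (y + z) =
    (s / (t + s)) *: (x + t *: y) + (t / (t + s)) *: (x + s *: z).
  rewrite !scalerDr !scalerA addrACA -scalerDl.
  rewrite (_ : s / (t + s) + t / (t + s) = 1) ?scale1r; last by field.
  by rewrite /k; congr (_ + (_ *: _ + _ *: _)); field.
have := ler_normD ((s / (t + s)) *: (x + t *: y)) ((t / (t + s)) *: (x + s *: z)).
rewrite (@normrZ _ _ (s / (t + s))) (@normrZ _ _ (t / (t + s))).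
rewrite (gtr0_norm (divr_gt0 s0 ts)) (gtr0_norm (divr_gt0 t0 ts)).
set a := `|x + t *: y|; set b := `|x + s *: z| => H.
have -> : ((a - `|x|) / t + (b - `|x|) / s) * k =
    s / (t + s) * a + t / (t + s) * b - `|x|.
  by rewrite /k; field; rewrite tn sn tsn.
by rewrite lerD2r.
Qed.

Let g_pos (c : R) y : 0 < c -> g (c *: y) <= c * g y.
Proof.
move=> c0; rewrite mulrC -ler_pdivrMr//; apply: g_ge => t t0; rewrite ler_pdivrMr//.
apply: le_trans (g_le _ (divr_gt0 t0 c0)) _.
rewrite /Q scalerA divfK ?gt_eqF// invf_div.
by rewrite mulrA [leLHS]mulrAC.
Qed.

(** Smoothness enters here. If the sum d of the two opposite derivatives were positive,
    [smooth_direction] with e = d/(2[|y|]) would give a step along y at which the two quotients add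
    up to at most d/2, yet they add up to at least d. *)
Let g_odd y : g (- y) = - g y.
Proof.
have g0 : 0 <= g 0.
  by apply: g_ge => t t0; rewrite /Q scaler0 addr0 subrr mul0r.
have : 0 <= g y + g (- y) by rewrite (le_trans g0)// -[X in g X](subrr y).
suff : g y + g (- y) <= 0 by lra.
have [->|y0] := eqVneq y 0.
  have g00 : g 0 <= 0.
    by rewrite (le_trans (g_le _ ltr01))// /Q scaler0 addr0 subrr mul0r.
  by rewrite oppr0; lra.
have ypos : 0 < `|y| by rewrite normr_gt0.
rewrite leNgt; apply/negP => h.
have [t t0 Ht] := smooth_direction x0 (divr_gt0 (divr_gt0 h ypos) (ltr0Sn R 1)).
have s0 : 0 < t / `|y| by rewrite divr_gt0.
have n1 : `| `|y|^-1 *: y| = 1 by rewrite normrZ normfV normr_id mulVf// gt_eqF.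
have := Ht _ n1; rewrite !scalerA => {}Ht.
have := g_le y s0; have := g_le (- y) s0.
rewrite /Q scalerN !ler_pdivlMr// => H1 H2.
have : (g y + g (- y)) * (t / `|y|) <= (g y + g (- y)) / `|y| / 2 * t by lra.
rewrite [leRHS](_ : _ = (g y + g (- y)) * (t / `|y|) / 2); last first.
  by field; rewrite gt_eqF.
have := mulr_gt0 h s0; lra.
Qed.

(** Subadditivity at -y and -z, combined with oddness, is the reverse inequality. *)
Let g_add y z : g (y + z) = g y + g z.
Proof.
have := g_sub y z; have := g_sub (- y) (- z); rewrite -opprD !g_odd; lra.
Qed.

Let g_scale (c : R) y : g (c *: y) = c * g y.
Proof.
have P (b : R) z : 0 < b -> g (b *: z) = b * g z.
  move=> b0; apply/eqP; rewrite eq_le g_pos//=.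
  have b'0 : 0 < b^-1 by rewrite invr_gt0.
  have := g_pos (b *: z) b'0; rewrite scalerA mulVf ?gt_eqF// scale1r.
  by rewrite mulrC ler_pdivlMr// mulrC.
have [c0|c0|->] := ltgtP c 0; last 1 first.
- by rewrite scale0r mul0r; have := g_add 0 0; rewrite addr0; lra.
- by rewrite -[c]opprK scaleNr g_odd P ?mulNr// oppr_gt0.
- exact: P.
Qed.

Let g_norm y : `|g y| <= `|y|.
Proof.
have H z : g z <= `|z|.
  apply: le_trans (g_le _ ltr01) _; rewrite /Q divr1 scale1r.
  have := ler_normD x z; lra.
by rewrite ler_norml H lerNl -g_odd -[leRHS]normrN H.
Qed.

Let g_self : g x = `|x|.
Proof.
have H t : 0 < t -> Q t x = `|x|.
  move=> t0; rewrite /Q -[X in X + t *: x]scale1r -scalerDl normrZ.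
  rewrite gtr0_norm ?addr_gt0// (mulrDl 1 t) mul1r addrAC subrr add0r.
  by rewrite mulrAC mulfV ?mul1r// gt_eqF.
apply/eqP; rewrite eq_le -{1}(H 1 ltr01) g_le//=.
by apply: g_ge => t t0; rewrite H.
Qed.

(* The directional derivatives of the norm at [x] form a linear functional,
   which replaces the Hahn-Banach theorem here. *)
Lemma duality_set_ex_neq0 : duality_set x !=set0.
Proof.
(* The derivative [g] is bounded by the norm and equals [|x|] at x, so the factor [|x|] produces a
   functional of norm [|x|]. *)
pose G (y : E) : R^o := `|x| * g y.
have Glin : linear G.
  move=> c y z; rewrite /G g_add g_scale mulrDr mulrCA.
  by have -> : c *: (`|x| * g y : R^o) = c * (`|x| * g y) by [].
pose h : {linear E -> R^o} := HB.pack G (GRing.isLinear.Build R E R^o *:%R G Glin).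
have Gn y : `|G y| <= `|x| * `|y|.
  by rewrite /G (normrM (`|x| : R)) normr_id ler_wpM2l.
have Gcont : continuous G.
  apply: (linear_bounded_continuous h).1; apply/bounded_funP => r.
  by exists (`|x| * r) => y yr; rewrite (le_trans (Gn y))// ler_wpM2l.
have GP : G \in continuous_linear_form by rewrite inE.
pose J0 : dual E := Dual GP.
have JE y : J0 y = `|x| * g y by [].
have nJ : `|x| = `|J0|.
  apply/eqP; rewrite eq_le; apply/andP; split.
    have := dual_app_le J0 x; rewrite JE g_self ler_pM2r ?normr_gt0//.
  apply: dual_norm_le_unit => // y y1; apply: le_trans (ler_norm _) _.
  by rewrite (le_trans (Gn y))// y1 mulr1.
by exists J0; split; rewrite // -nJ JE g_self.
Qed.

End DirectionalDerivative.

(** * The duality map, the Lyapunov functional and the generalized projection *)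

Section DualityMap.
Context {R : realType} {E : completeNormedModType R}.
Hypotheses (hsmooth : uniformly_smooth E) (hconvex : uniformly_convex E).
Implicit Types (x y w : E) (f g : dual E).

(** Testing f at x + ty and g at x - ty and adding bounds t (f - g) y by the second difference of
    the norm at x plus terms of order [|x - w|]. Arbitrary selections f and g are allowed because
    both the single-valuedness and the continuity of J are derived from this estimate. *)
Lemma duality_set_close x (e : R) : x != 0 -> 0 < e -> exists2 d : R, 0 < d &
  forall w f g, `|x - w| < d -> duality_set x f -> duality_set w g ->
    `|f - g| <= e.
Proof.
move=> x0 e0; have xpos : 0 < `|x| by rewrite normr_gt0.
have e'0 : 0 < e / (2 * `|x|) by rewrite divr_gt0// mulr_gt0.
have [t t0 Ht] := smooth_direction hsmooth x0 e'0.
(* Dominates the total coefficient of [|x - w|] in the final estimate; these terms then use at most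
   t e / 2, and the second difference uses the other half. *)
pose c := 4 * `|x| + 3 + t.
have c0 : 0 < c by rewrite /c; lra.
exists (Num.min 1 (t * e / 2 / c)).
  by rewrite lt_min ltr01/= !divr_gt0// mulr_gt0.
move=> w f g; rewrite lt_min => /andP[d1 dc] [fx nf] [gw ng].
apply: dual_norm_le_unit; first exact: ltW.
move=> y y1; rewrite -(ler_pM2l t0) dual_funB.
have hf := dual_app_le f (x + t *: y); have hg := dual_app_le g (x - t *: y).
have hgx := dual_app_le g (w - x).
rewrite dual_appB gw -ng distrC in hgx.
rewrite dual_appD dual_appZ fx -nf in hf; rewrite dual_appB dual_appZ -ng in hg.
have Hy := Ht y y1.
have tri : `|x - t *: y| <= `|x| + t.
  by rewrite (le_trans (ler_normB _ _))// [`|t *: y|]normrZ y1 mulr1 gtr0_norm.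
have w1 : `|w| <= `|x| + `|x - w|.
  by rewrite -[X in `|X| <= _](subKr x) (le_trans (ler_normB _ _)).
have w2 : `|x| <= `|w| + `|x - w|.
  by rewrite -[X in `|X| <= _](subrK w) addrC (le_trans (ler_normD _ _)).
move: hf hg hgx Hy; set fx' : R := f y; set gx' : R := g y; set gx : R := g x.
set dl := `|x - w| in d1 dc w1 w2 *; set A := `|x + t *: y|.
set B := `|x - t *: y| in tri *; set X := `|x| in xpos c c0 w1 w2 tri dc *.
set W := `|w| in w1 w2 *.
move=> hf hg hgx Hy.
have dl0 : 0 <= dl by exact: normr_ge0.
have B0 : 0 <= B by exact: normr_ge0.
have W0 : 0 <= W by exact: normr_ge0.
have Hy' : X * (A + B) <= 2 * X ^+ 2 + e * t / 2.
  have -> : 2 * X ^+ 2 + e * t / 2 = X * (2 * X + e / (2 * X) * t).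
    by field; rewrite gt_eqF.
  by rewrite ler_pM2l.
have dcl : dl * c < t * e / 2 by rewrite -ltr_pdivlMr.
have WB : (W - X) * B <= dl * (X + t).
  apply: (@le_trans _ _ (dl * B)); first by rewrite ler_wpM2r//; lra.
  by rewrite ler_wpM2l.
have XW : X ^+ 2 - W ^+ 2 <= dl * (X + W).
  have : (X - W) * (X + W) <= dl * (X + W) by rewrite ler_wpM2r//; lra.
  nra.
have Wd : W * dl <= (X + 1) * dl by rewrite ler_wpM2r//; lra.
rewrite /c in dcl; nra.
Qed.

Lemma duality_set_uniq x f g : duality_set x f -> duality_set x g -> f = g.
Proof.
move=> xf xg; apply/eqP; rewrite -subr_eq0 -normr_eq0 eq_le normr_ge0 andbT.
have [x0|x0] := eqVneq x 0.
  have [_ nf] := xf; have [_ ng] := xg.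
  by rewrite (le_trans (ler_normB _ _))// -nf -ng x0 normr0 addr0.
rewrite leNgt; apply/negP => h.
have [d d0 Hd] := duality_set_close x0 (divr_gt0 h (ltr0Sn R 1)).
have := Hd x f g; rewrite subrr normr0 => /(_ d0 xf xg); lra.
Qed.

Lemma JP x : duality_set x (J x).
Proof.
apply: xgetPex; have [->|x0] := eqVneq x 0.
  by exists 0; split; rewrite /= !normr0// mulr0.
exact: duality_set_ex_neq0.
Qed.

Lemma J_eq x f : duality_set x f -> J x = f.
Proof. exact: duality_set_uniq (JP x). Qed.

Lemma norm_J x : `|J x| = `|x|. Proof. by have [_] := JP x. Qed.

Lemma J_self x : J x x = `|x| ^+ 2 :> R.
Proof. by have [-> _] := JP x; rewrite norm_J expr2. Qed.

Lemma cvg_J (u : nat -> E) (p : E) : u @ \oo --> p -> J (u n) @[n --> \oo] --> J p.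
Proof.
move=> up; apply/cvgrPdist_lt => e e0.
have e20 : 0 < e / 2 by rewrite divr_gt0.
have [p0|p0] := eqVneq p 0.
  near=> n; rewrite (le_lt_trans (ler_normB _ _))// !norm_J p0 normr0 add0r.
  rewrite -[`|u n|]normrN -[- u n]add0r -p0; near: n; exact: cvgr_dist_lt.
have [d d0 Hd] := duality_set_close p0 e20.
near=> n; apply: (@le_lt_trans _ _ (e / 2)); last by lra.
apply: Hd (JP _) (JP _); near: n; exact: cvgr_dist_lt.
Unshelve. all: by end_near. Qed.

(** The minimizer x of the energy of f over the whole space is a preimage: varying along x gives f x
    = [|x|^2], and varying along unit vectors gives [|f| <= |x|]. *)
Lemma J_surj f : exists x, J x = f.
Proof.
have T0 : [set: E] !=set0 by exists 0.
have [x _ xmin] := energy_min_ex f hconvex T0 closedT (fun _ _ _ _ => I).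
exists x; apply: J_eq.
have fx : f x = `|x| ^+ 2 :> R.
  have H (t : R) : 2 * t * (f x : R) <= (2 * t + t ^+ 2) * `|x| ^+ 2.
    have := xmin (x + t *: x) I; rewrite /energy.
    rewrite -[X in X + t *: x]scale1r -scalerDl dual_appZ normrZ exprMn.
    rewrite real_normK ?num_real//; nra.
  apply/eqP; rewrite -subr_eq0; set d := _ - _ : R.
  have H' (t : R) : 2 * t * d <= t ^+ 2 * `|x| ^+ 2 by have := H t; rewrite /d; lra.
  have n0 : 0 < `|x| ^+ 2 + 1 by rewrite ltr_wpDl ?sqr_ge0.
  (* With N = [|x|^2 + 1], this value of t gives 2 d^2 / N <= (d^2 / N)([|x|^2] / N) <= d^2 / N,
     which forces d = 0. *)
  have := H' (d / (`|x| ^+ 2 + 1)).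
  rewrite (_ : 2 * _ * d = 2 * (d ^+ 2 / (`|x| ^+ 2 + 1))); last first.
    by field; rewrite gt_eqF.
  rewrite (_ : (d / _) ^+ 2 * _ =
    d ^+ 2 / (`|x| ^+ 2 + 1) * (`|x| ^+ 2 / (`|x| ^+ 2 + 1))); last first.
    by field; rewrite gt_eqF.
  have q1 : `|x| ^+ 2 / (`|x| ^+ 2 + 1) <= 1 by rewrite ler_pdivrMr// mul1r lerDl.
  have q0 : 0 <= d ^+ 2 / (`|x| ^+ 2 + 1) by rewrite divr_ge0 ?sqr_ge0// ltW.
  have := ler_wpM2l q0 q1; rewrite mulr1 => h1 h2.
  have : d ^+ 2 / (`|x| ^+ 2 + 1) <= 0 by lra.
  rewrite ler_pdivrMr// mul0r => d20.
  by rewrite -sqrf_eq0 eq_le d20 sqr_ge0.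
have nfx : `|f| <= `|x|.
  apply: dual_norm_le_unit => // y y1.
  rewrite leNgt; apply/negP => h.
  have H (t : R) : 0 < t -> 2 * (f y : R) <= 2 * `|x| + t.
    move=> t0; have := xmin (x + t *: y) I; rewrite /energy dual_appD dual_appZ.
    have : `|x + t *: y| ^+ 2 <= (`|x| + t) ^+ 2.
      rewrite ler_sqr ?nnegrE ?addr_ge0 ?(ltW t0)//.
      by rewrite (le_trans (ler_normD _ _))// [`|t *: y|]normrZ y1 mulr1 gtr0_norm.
    move=> h1 h2; rewrite -(ler_pM2l t0); nra.
  (* Taking the excess f y - [|x|] itself as the step t bounds twice the excess by the excess. *)
  have t0 : 0 < (f y : R) - `|x| by rewrite subr_gt0.
  have := H _ t0; move: t0; lra.
have nf : `|x| = `|f|.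
  apply/eqP; rewrite eq_le nfx andbT.
  have [->|x0] := eqVneq x 0; first by rewrite normr0.
  have := dual_app_le f x; rewrite fx expr2 ler_pM2r ?normr_gt0//.
by split; rewrite // fx -nf expr2.
Qed.

Lemma JinvK f : J (Jinv f) = f.
Proof. by apply: (@xgetPex _ 0 [set x | J x = f]); exact: J_surj. Qed.

Lemma phiE x y : phi x y = `|x| ^+ 2 - 2 * (J y x : R) + `|y| ^+ 2.
Proof. by []. Qed.

Lemma phi_energy x y : phi x y = energy (J y) x + `|y| ^+ 2.
Proof. by []. Qed.

Lemma phi_ge_sq x y : (`|x| - `|y|) ^+ 2 <= phi x y.
Proof. by rewrite phi_energy -[`|y|]norm_J; exact: energy_norm_sq. Qed.

Lemma phi_ge0 x y : 0 <= phi x y.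
Proof. exact: le_trans (sqr_ge0 _) (phi_ge_sq x y). Qed.

Lemma phi_xx x : phi x x = 0.
Proof. by rewrite phiE J_self; ring. Qed.

(** With m the norm of the midpoint, evaluating J y at x + y bounds J y x by 2 m [|y| - |y|^2].
    Completing the square in [|y| - m] gives even twice the gap as a lower bound for phi. *)
Lemma phi_ge_gap x y : gap x y <= phi x y.
Proof.
suff : 2 * gap x y <= phi x y by have := phi_ge0 x y; lra.
have := dual_app_le (J y) (x + y); rewrite norm_J dual_appD J_self normD_half.
rewrite phiE /gap; set m := `|2^-1 *: (x + y)|; set j : R := J y x.
have := sqr_ge0 (`|y| - m); nra.
Qed.

(** Three-point identity of the Lyapunov functional. *)
Lemma phi3 x y w : phi x w = phi x y + phi y w + 2 * ((J y - J w) (x - y) : R).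
Proof. by rewrite !phiE dual_funB !dual_appB J_self; ring. Qed.

Lemma cvg_phi (u v : nat -> E) (p q : E) : u @ \oo --> p -> v @ \oo --> q ->
  phi (u n) (v n) @[n --> \oo] --> phi p q.
Proof.
move=> up vq; apply: cvgD; last by apply: cvgM; exact: cvg_norm.
apply: cvgB; first by apply: cvgM; exact: cvg_norm.
by apply: cvgM; [exact: cvg_cst|apply: cvg_dual_app => //; exact: cvg_J].
Qed.

Lemma phi_cvg0_l (M : R) (u v : nat -> E) : (forall n, `|u n| <= M) ->
  phi (u n) (v n) @[n --> \oo] --> (0 : R) -> `|u n - v n| @[n --> \oo] --> (0 : R).
Proof.
move=> uM h; apply: (gap_cvg0 hconvex uM h) => n; first exact: phi_ge_sq.
exact: phi_ge_gap.
Qed.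

Lemma phi_cvg0_r (M : R) (u v : nat -> E) : (forall n, `|v n| <= M) ->
  phi (u n) (v n) @[n --> \oo] --> (0 : R) -> `|u n - v n| @[n --> \oo] --> (0 : R).
Proof.
move=> vM h; under eq_fun do rewrite distrC.
apply: (gap_cvg0 hconvex vM h) => n; last by rewrite gapC; exact: phi_ge_gap.
by rewrite -sqrrN opprB; exact: phi_ge_sq.
Qed.

(** phi(p, w) depends on w only through J w, since J preserves norms; hence phi(p, w_n) tends to
    phi(p, p) = 0. *)
Lemma cvg_J_inv (w : nat -> E) (p : E) :
  J (w n) @[n --> \oo] --> J p -> w @ \oo --> p.
Proof.
move=> Jw; apply: (@cvg_from_dist0 _ _ _ (fun=> p)); first exact: cvg_cst.
under eq_fun do rewrite distrC.
apply: (@phi_cvg0_l `|p|) => //.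
rewrite -(phi_xx p).
have -> : (fun n => phi p (w n)) =
    (fun n => `|p| ^+ 2 - 2 * (J (w n) p : R) + `|J (w n)| ^+ 2).
  by apply/funext => n; rewrite phiE norm_J.
rewrite phiE -{3}norm_J; apply: cvgD; last by apply: cvgM; exact: cvg_norm.
apply: cvgB; first exact: cvg_cst.
by apply: cvgM; [exact: cvg_cst|apply: cvg_dual_app => //; exact: cvg_cst].
Qed.

Lemma is_gen_projP (K : set E) x p :
  is_gen_proj K x p <-> K p /\ forall y, K y -> phi p x <= phi y x.
Proof.
have lb : has_lbound [set phi y x | y in K].
  by exists 0 => _ [y _ <-]; exact: phi_ge0.
split=> -[Kp H]; split=> //.
  by move=> y Ky; rewrite H; apply: ge_inf => //; exists y.
apply/eqP; rewrite eq_le; apply/andP; split.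
  by apply: lb_le_inf => [|_ [y Ky <-]]; [exists (phi p x), p|exact: H].
by apply: ge_inf => //; exists p.
Qed.

Lemma gen_projP (K : set E) x : K !=set0 -> closed K -> midconvex K ->
  K (gen_proj K x) /\ forall y, K y -> phi (gen_proj K x) x <= phi y x.
Proof.
move=> K0 cK mK; apply/is_gen_projP.
apply: (@xgetPex _ 0 [set p | is_gen_proj K x p]).
have [p Kp pmin] := energy_min_ex (J x) hconvex K0 cK mK.
exists p; apply/is_gen_projP; split=> // y Ky.
by rewrite !phi_energy lerD2r pmin.
Qed.

Lemma gen_proj_eq (K : set E) x p : midconvex K -> K p ->
  (forall y, K y -> phi p x <= phi y x) -> gen_proj K x = p.
Proof.
move=> mK Kp pmin.
have : is_gen_proj K x (gen_proj K x).
  apply: (@xgetPex _ 0 [set p | is_gen_proj K x p]).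
  by exists p; apply/is_gen_projP.
move=> /is_gen_projP[Kq qmin].
apply: (energy_min_uniq (f := J x) hconvex mK) => // y Ky.
  by have := qmin _ Ky; rewrite !phi_energy lerD2r.
by have := pmin _ Ky; rewrite !phi_energy lerD2r.
Qed.

End DualityMap.

(** * Auxiliary facts: convexity, equilibrium bifunctions, relative limits *)

Lemma infinite_set_near (S : set nat) (P : nat -> Prop) :
  infinite_set S -> (\forall n \near \oo, P n) -> exists2 n, S n & P n.
Proof.
move=> Sinf [N _ HN]; apply: contrapT => H; apply: Sinf.
apply: (sub_finite_set _ (finite_II N)) => n Sn /=.
by rewrite ltnNge; apply/negP => Nn; apply: H; exists n => //; exact: HN.
Qed.

Lemma norm_conv3_sq {R : realType} {V : normedModType R} (a1 a2 a3 : R)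
    (f1 f2 f3 : V) : 0 <= a1 -> 0 <= a2 -> 0 <= a3 -> a1 + a2 + a3 = 1 ->
  `|a1 *: f1 + a2 *: f2 + a3 *: f3| ^+ 2 <=
    a1 * `|f1| ^+ 2 + a2 * `|f2| ^+ 2 + a3 * `|f3| ^+ 2.
Proof.
move=> h1 h2 h3 hs.
have H : `|a1 *: f1 + a2 *: f2 + a3 *: f3| <= a1 * `|f1| + a2 * `|f2| + a3 * `|f3|.
  rewrite (le_trans (ler_normD _ _))// lerD//.
    by rewrite (le_trans (ler_normD _ _))// !normrZ !ger0_norm.
  by rewrite normrZ ger0_norm.
apply: (@le_trans _ _ ((a1 * `|f1| + a2 * `|f2| + a3 * `|f3|) ^+ 2)).
  by rewrite ler_sqr ?nnegrE// !addr_ge0// mulr_ge0.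
set x := `|f1|; set y := `|f2|; set z := `|f3|.
(* Variance identity for three weights of sum 1. *)
rewrite -subr_ge0 (_ : _ - _ = a1 * a2 * (x - y) ^+ 2 + a1 * a3 * (x - z) ^+ 2
    + a2 * a3 * (y - z) ^+ 2).
  have P (a b c : R) : 0 <= a -> 0 <= b -> 0 <= a * b * c ^+ 2.
    by move=> *; rewrite mulr_ge0 ?sqr_ge0// mulr_ge0.
  by apply: addr_ge0; [apply: addr_ge0|]; exact: P.
have -> : a3 = 1 - a1 - a2 by lra.
ring.
Qed.

(** Minty's argument: at w = tv + (1-t)p, (A1) and convexity give 0 = f w w <= t f w v + (1-t) f w
    p, hence f w v >= 0, and (A3) lets t tend to 0. *)
Lemma equilibrium_minty {R : realType} {X : normedModType R} (D : set X)
    (f : X -> X -> R) (p : X) : convex_set D -> equilibrium_bifunction D f ->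
  D p -> (forall v, D v -> f v p <= 0) -> forall v, D v -> 0 <= f p v.
Proof.
move=> cD [A1 A2 A3 A4] Dp H v Dv.
rewrite -lee_fin; apply: le_trans (A3 p v v Dp Dv Dv).
(* The upper limit is an infimum of suprema over neighborhoods, so one t in (0,1) in each
   neighborhood suffices. *)
rewrite /limf_esup; apply: le_ereal_inf_tmp => _ [V V0 <-].
have : \forall t \near (0 : R)^'+, [/\ V t, 0 < t & t < 1].
  near=> t; split; near: t => //; first exact: nbhs_right_gt.
  exact: nbhs_right_lt.
move=> /filter_ex[t [Vt t0 t1]].
apply: (@le_trans _ _ (f (t *: v + (1 - t) *: p) v)%:E); last first.
  by apply: ereal_sup_ubound; exists t.
set w := t *: v + (1 - t) *: p.
have t01 : 0 <= t <= 1 by rewrite !ltW.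
have Dw : D w by exact: convex_set_conv.
have H1 : f w w <= t * f w v + (1 - t) * f w p.
  exact: (A4 w Dw).1 (Itv01 (ltW t0) (ltW t1)) v p (mem_set Dv) (mem_set Dp).
have H2 : (1 - t) * f w p <= 0.
  by apply: mulr_ge0_le0; [rewrite subr_ge0 ltW|exact: H].
rewrite lee_fin -(pmulr_rge0 _ t0).
by rewrite A1// in H1; lra.
Unshelve. all: by end_near. Qed.

(** Gives access to the semicontinuity in (A4) and to continuity within C, both relative to the
    subspace topology. *)
Lemma cvg_subspace {X : topologicalType} (D : set X) (u : nat -> X) (l : X) :
  (forall n, D (u n)) -> D l -> u @ \oo --> l ->
  (u : nat -> subspace D) @ \oo --> (l : subspace D).
Proof.
move=> Du Dl ul V /(@nbhs_subspace_ex X D V l Dl)[W /ul Wl VW].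
apply: (@filterS _ \oo _ (u @^-1` W) (u @^-1` V) _ Wl) => n Wn.
by have : (W `&` D) (u n) by []; rewrite -VW => -[].
Qed.

Lemma cvg_within_continuous {X Y : topologicalType} (D : set X) (F : X -> Y)
    (u : nat -> X) (l : X) : {within D, continuous F} ->
  (forall n, D (u n)) -> D l -> u @ \oo --> l -> F (u n) @[n --> \oo] --> F l.
Proof.
by move=> cF Du Dl ul; apply: cvg_comp (cvg_subspace Du Dl ul) (cF l).
Qed.

Lemma scaled_residual_cvg0 {R : realType} (a : R) (r t : nat -> R) :
  0 < a -> (forall n, a <= r n) -> t @ \oo --> (0 : R) ->
  (r n)^-1 * t n @[n --> \oo] --> (0 : R).
Proof.
move=> a0 ar t0; apply: norm_cvg0.
have H : a^-1 * `|t n| @[n --> \oo] --> (0 : R).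
  rewrite -[X in _ --> X](mulr0 a^-1) -(@normr0 _ R).
  by apply: cvgM; [exact: cvg_cst|exact: cvg_norm].
apply: (squeeze_cvgr _ (cvg_cst 0) H); apply: nearW => n.
rewrite normr_ge0/= normrM ler_wpM2r// ger0_norm; last first.
  by rewrite invr_ge0 (le_trans _ (ar n))// ltW.
by rewrite lef_pV2 ?posrE// (lt_le_trans a0).
Qed.

(** * Half-spaces, resolvent inequalities and limits of resolvents *)

Section Scheme.
Context {R : realType} {E : completeNormedModType R}.
Hypotheses (hsmooth : uniformly_smooth E) (hconvex : uniformly_convex E).
Implicit Types (C K : set E) (p q s v w z : E).

(** The terms [|v|^2] cancel, so the inequality defines a closed half-space. *)
Lemma closed_phi_le K w s : closed K ->
  closed [set v | K v /\ phi v w <= phi v s].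
Proof.
move=> cK.
pose b : R := (`|s| ^+ 2 - `|w| ^+ 2) / 2.
have P v : phi v w <= phi v s <-> ((J s - J w) v : R) <= b.
  by rewrite !phiE dual_funB /b; split; lra.
have -> : [set v | K v /\ phi v w <= phi v s] =
    K `&` (fun v => (J s - J w) v : R) @^-1` [set t | t <= b].
  by apply/seteqP; split=> v [Kv /P].
apply: closedI => //.
have : continuous (fun v => (J s - J w) v : R) by exact: dual_continuous.
by move/continuous_closedP; apply; exact: closed_le.
Qed.

Lemma midconvex_phi_le K w s : midconvex K ->
  midconvex [set v | K v /\ phi v w <= phi v s].
Proof.
move=> mK a b [Ka Ha] [Kb Hb]; split; first exact: mK.
move: Ha Hb; rewrite !phiE !dual_appZ !dual_appD; lra.
Qed.

(** As a function of J w, phi(q, w) is affine up to the convex term [|J w|^2]. *)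
Lemma phi_conv3 (a1 a2 a3 : R) q w (v1 v2 v3 : E) :
  0 <= a1 -> 0 <= a2 -> 0 <= a3 -> a1 + a2 + a3 = 1 ->
  J w = a1 *: J v1 + a2 *: J v2 + a3 *: J v3 ->
  phi q w <= a1 * phi q v1 + a2 * phi q v2 + a3 * phi q v3.
Proof.
move=> h1 h2 h3 hs Jw.
have := norm_conv3_sq (J v1) (J v2) (J v3) h1 h2 h3 hs.
have wq : J w q = a1 * (J v1 q : R) + a2 * (J v2 q : R) + a3 * (J v3 q : R) :> R.
  by rewrite Jw !dual_funD !dual_funZ.
rewrite -Jw !norm_J// !phiE wq.
have {1}-> : `|q| ^+ 2 = a1 * `|q| ^+ 2 + a2 * `|q| ^+ 2 + a3 * `|q| ^+ 2.
  by rewrite -!mulrDl hs mul1r.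
lra.
Qed.

Lemma phi_resolvent q s z : 0 <= (J z - J s) (q - z) :> R ->
  phi q z + phi z s <= phi q s.
Proof. by move=> h; rewrite (phi3 hsmooth q z s); lra. Qed.

(** Testing the resolvent inequality at q leaves only the duality term, since (A2) and q in [EP]
    give f (J z) (J q) <= 0. *)
Lemma EP_resolvent C (f : dual E -> dual E -> R) (r : R) q s z :
  equilibrium_bifunction (J @` C) f -> 0 < r -> EP C f q -> C z ->
  (forall v, C v -> 0 <= f (J z) (J v) + r^-1 * (J z - J s) (v - z)) ->
  phi q z + phi z s <= phi q s.
Proof.
move=> [_ A2 _ _] r0 [Cq fq] Cz Hz; apply: phi_resolvent.
have r'0 : 0 < r^-1 by rewrite invr_gt0.
rewrite -(pmulr_rge0 _ r'0); have := Hz q Cq; have := fq z Cz.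
have := A2 (J z) (J q) (ex_intro2 _ _ z Cz erefl) (ex_intro2 _ _ q Cq erefl).
set t : R := (J z - J s) (q - z); lra.
Qed.

(** As for [EP_resolvent], with monotonicity of A in the role of (A2). *)
Lemma VI_resolvent C (A : E -> dual E) (r : R) q s z :
  monotone_on C A -> 0 < r -> VI C A q -> C z ->
  (forall v, C v -> 0 <= A z (v - z) + r^-1 * (J z - J s) (v - z) :> R) ->
  phi q z + phi z s <= phi q s.
Proof.
move=> mA r0 [Cq Aq] Cz Hz; apply: phi_resolvent.
have r'0 : 0 < r^-1 by rewrite invr_gt0.
rewrite -(pmulr_rge0 _ r'0); have := Hz q Cq; have := Aq z Cz.
have := mA z q Cz Cq; rewrite dual_funB !dual_appB.
set t : R := (J z - J s) q - _; lra.
Qed.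

Lemma residual_cvg0 (a : R) (r : nat -> R) (z s : nat -> E) p v :
  0 < a -> (forall n, a <= r n) -> z @ \oo --> p -> s @ \oo --> p ->
  (r n)^-1 * ((J (z n) - J (s n)) (v - z n) : R) @[n --> \oo] --> (0 : R).
Proof.
move=> a0 ar zp sp; apply: (scaled_residual_cvg0 a0 ar).
have -> : (0 : R) = (J p - J p) (v - p) by rewrite subrr.
apply: cvg_dual_app; last by apply: cvgB => //; exact: cvg_cst.
by apply: cvgB; exact: cvg_J.
Qed.

(** By [equilibrium_minty] it is enough that f_i(J v, J p) <= 0. A positive value b would, by lower
    semicontinuity, keep f_i(J v, J z_n) above b/2 eventually, while (A2) and the resolvent
    inequality bound it by a residual tending to 0. *)
Lemma EP_limit C (f : nat -> dual E -> dual E -> R) (mu : nat -> nat) i (a : R)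
    (r : nat -> R) (z s : nat -> E) p :
  closed C -> convex_set (J @` C) -> equilibrium_bifunction (J @` C) (f i) ->
  infinite_set [set n | mu n = i] -> 0 < a -> (forall n, a <= r n) ->
  z @ \oo --> p -> s @ \oo --> p -> (forall n, C (z n)) ->
  (forall n v, C v ->
    0 <= f (mu n) (J (z n)) (J v) + (r n)^-1 * (J (z n) - J (s n)) (v - z n)) ->
  EP C (f i) p.
Proof.
move=> cC cJC hf imu a0 ar zp sp Cz Hz.
have Cp : C p by apply: (closed_cvg C cC _ _ zp); exact: nearW.
have JC v : C v -> (J @` C) (J v) by move=> Cv; exists v.
split=> // y Cy; apply: (equilibrium_minty cJC hf (JC _ Cp) _ (JC _ Cy)).
move=> _ [v Cv <-]; have [_ A2 _ A4] := hf.
rewrite leNgt; apply/negP => fpos.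
set b := f i (J v) (J p) in fpos.
have b20 : 0 < b / 2 by rewrite divr_gt0.
have bb : ((b / 2)%:E < (f i (J v) (J p))%:E)%E by rewrite lte_fin -/b; lra.
have [V Vp HV] := (A4 (J v) (JC _ Cv)).2 (J p) (b / 2) bb.
have Jz : \forall n \near \oo, V (J (z n)).
  have Jzp := cvg_subspace (fun n => JC _ (Cz n)) (JC _ Cp) (cvg_J hsmooth zp).
  exact: Jzp Vp.
have res : \forall n \near \oo,
    (r n)^-1 * ((J (z n) - J (s n)) (v - z n) : R) < b / 2.
  exact: cvgr_lt (residual_cvg0 v a0 ar zp sp) _ b20.
(* A single late index with [mu n = i] already gives the contradiction; no subsequence is
   extracted. *)
have [n mun [/HV Vn rn]] := infinite_set_near imu (filterI Jz res).
move: Vn; rewrite lte_fin => Vn.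
have := Hz n v Cv; rewrite mun; have := A2 _ _ (JC _ (Cz n)) (JC _ Cv).
move: rn; set t : R := (J (z n) - J (s n)) _; lra.
Qed.

(** Continuity of A_j lets the left side converge directly; a negative limit would be visible at
    some index with [nu n = j]. *)
Lemma VI_limit C (A : nat -> E -> dual E) (nu : nat -> nat) j (a : R)
    (r : nat -> R) (u s : nat -> E) p :
  closed C -> {within C, continuous (A j)} ->
  infinite_set [set n | nu n = j] -> 0 < a -> (forall n, a <= r n) ->
  u @ \oo --> p -> s @ \oo --> p -> (forall n, C (u n)) ->
  (forall n v, C v ->
    0 <= A (nu n) (u n) (v - u n)
         + (r n)^-1 * (J (u n) - J (s n)) (v - u n) :> R) ->
  VI C (A j) p.
Proof.
move=> cC cA inu a0 ar up sp Cu Hu.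
have Cp : C p by apply: (closed_cvg C cC _ _ up); exact: nearW.
split=> // v Cv; rewrite leNgt; apply/negP => Aneg.
have lim : (A j (u n) (v - u n) : R)
    + (r n)^-1 * ((J (u n) - J (s n)) (v - u n) : R) @[n --> \oo]
    --> (A j p (v - p) : R).
  rewrite -[X in _ --> X]addr0; apply: cvgD; last exact: residual_cvg0 a0 ar up sp.
  apply: cvg_dual_app; first exact: cvg_within_continuous cA Cu Cp up.
  by apply: cvgB => //; exact: cvg_cst.
have [n nun ltn] := infinite_set_near inu (cvgr_lt _ lim _ Aneg).
by have := Hu n v Cv; rewrite nun leNgt ltn.
Qed.

End Scheme.

(* All sequences and families are indexed from 0 instead of 1: x 0 is x_1,
   Cn 0 is C_1, and so on. *)
Theorem proposition4p1 (R : realType) (E : completeNormedModType R)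
    (hsmooth : uniformly_smooth E) (hconvex : uniformly_convex E)
    (C : set E) (C0 : C !=set0) (Cclosed : closed C) (Cconvex : convex_set C)
    (JCclosed : closed (J @` C)) (JCconvex : convex_set (J @` C))
    (f : nat -> dual E -> dual E -> R)
    (hf : forall i, equilibrium_bifunction (J @` C) (f i))
    (A : nat -> E -> dual E)
    (Acont : forall j, {within C, continuous (A j)})
    (Amono : forall j, monotone_on C (A j))
    (T : nat -> E -> dual E)
    (hT : forall n, gen_Jstar_nonexpansive C (T n))
    (Gamma : set (E -> dual E))
    (hGamma : forall S, Gamma S ->
       Jstar_closed C S /\ gen_Jstar_nonexpansive C S)
    (hFJ : (\bigcap_n FJ C (T n)) = FJ_family C Gamma)
    (hFJ0 : FJ_family C Gamma !=set0)
    (hNST : NST_condition C T Gamma)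
    (B : set E)
    (hB : B = FJ_family C Gamma `&` (\bigcap_i EP C (f i))
                `&` (\bigcap_j VI C (A j)))
    (B0 : B !=set0) (Bclosed : closed B) (Bconvex : convex_set B)
    (mu nu : nat -> nat)
    (hmu : forall i, infinite_set [set n | mu n = i])
    (hnu : forall j, infinite_set [set n | nu n = j])
    (rho : {nonneg R}) (rho0 : 0 < rho%:num)
    (h : {fun C >-> C}) (hh : contraction rho h)
    (ubar : E) (Cubar : C ubar)
    (lambda sigma : nat -> R)
    (hlambda : forall n, 0 <= lambda n < 1)
    (hsigma : forall n, 0 <= sigma n < 1)
    (hls : forall n, lambda n + sigma n < 1)
    (lambda0 : lambda @ \oo --> (0 : R)) (sigma0 : sigma @ \oo --> (0 : R))
    (alpha1 alpha2 alpha3 : R)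
    (halpha1 : 0 < alpha1 < 1) (halpha2 : 0 < alpha2 < 1)
    (halpha3 : 0 < alpha3 < 1) (halpha : alpha1 + alpha2 + alpha3 = 1)
    (a : R) (a0 : 0 < a) (r : nat -> R) (hr : forall n, a <= r n)
    (x s z u y : nat -> E) (Cn : nat -> set E)
    (hx0 : C (x 0%N)) (hC0 : Cn 0%N = C)
    (hs : forall n, s n = Jinv (lambda n *: J (h (x n)) + sigma n *: J ubar
                                + (1 - lambda n - sigma n) *: J (x n)))
    (hz : forall n, [set w | C w /\ forall v, C v ->
            0 <= f (mu n) (J w) (J v) + (r n)^-1 * (J w - J (s n)) (v - w)]
          = [set z n])
    (hu : forall n, [set w | C w /\ forall v, C v ->
            0 <= A (nu n) w (v - w) + (r n)^-1 * (J w - J (s n)) (v - w)]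
          = [set u n])
    (hy : forall n, y n = Jinv (alpha1 *: J (s n) + alpha2 *: J (z n)
                                + alpha3 *: T n (u n)))
    (hCn : forall n, Cn n.+1 = [set v | Cn n v /\ phi v (y n) <= phi v (s n)])
    (hx : forall n, x n.+1 = gen_proj (Cn n.+1) (x 0%N)) :
  [/\ `|s n - x n| @[n --> \oo] --> (0 : R),
      `|y n - x n.+1| @[n --> \oo] --> (0 : R),
      `|z n - s n| @[n --> \oo] --> (0 : R),
      `|u n - s n| @[n --> \oo] --> (0 : R) &
      `|J (u n) - T n (u n)| @[n --> \oo] --> (0 : R)] /\
  [/\ s @ \oo --> gen_proj B (x 0%N),
      y @ \oo --> gen_proj B (x 0%N),
      z @ \oo --> gen_proj B (x 0%N) &
      u @ \oo --> gen_proj B (x 0%N)].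
Proof.

(* Resolvent inequalities and the key estimate *)
have JC v : C v -> (J @` C) (J v) by move=> Cv; exists v.
have r0 n : 0 < r n by exact: lt_le_trans a0 (hr n).
have Hz n : C (z n) /\ forall v, C v ->
    0 <= f (mu n) (J (z n)) (J v) + (r n)^-1 * (J (z n) - J (s n)) (v - z n).
  by have : [set z n] (z n) by []; rewrite -hz.
have Hu n : C (u n) /\ forall v, C v ->
    0 <= A (nu n) (u n) (v - u n) + (r n)^-1 * (J (u n) - J (s n)) (v - u n).
  by have : [set u n] (u n) by []; rewrite -hu.
have Cz n := (Hz n).1; have Cu n := (Hu n).1.
have /andP[al1 _] := halpha1; have /andP[al2 _] := halpha2.
have /andP[al3 _] := halpha3.
have Jy n : J (y n) = alpha1 *: J (s n) + alpha2 *: J (z n) + alpha3 *: T n (u n).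
  by rewrite hy JinvK.
have BE q : B q -> [/\ FJ_family C Gamma q, forall i, EP C (f i) q &
    forall j, VI C (A j) q].
  by rewrite hB => -[[Fq Eq] Vq]; split=> // i; [exact: Eq|exact: Vq].
have zs q n : B q -> phi q (z n) + phi (z n) (s n) <= phi q (s n).
  move=> /BE[_ Eq _].
  exact: (EP_resolvent hsmooth (hf (mu n)) (r0 n) (Eq _) (Cz n) (Hz n).2).
have us q n : B q -> phi q (u n) + phi (u n) (s n) <= phi q (s n).
  move=> /BE[_ _ Vq].
  exact: (VI_resolvent hsmooth (Amono (nu n)) (r0 n) (Vq _) (Cu n) (Hu n).2).
have key q n : B q ->
    alpha2 * phi (z n) (s n) + alpha3 * phi (u n) (s n) <=
    phi q (s n) - phi q (y n).
  move=> Bq; have [Fq _ _] := BE q Bq.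
  (* Since q is also a J-fixed point of T_n, the third term of the convexity bound is at most phi(q,
     u_n), to which the resolvent inequality applies. *)
  have FTq : FJ C (T n) q by move: Fq; rewrite -hFJ => /(_ n I).
  have Tq := (hT n).2 _ _ (Cu n) FTq.
  have Jy' : J (y n) = alpha1 *: J (s n) + alpha2 *: J (z n)
      + alpha3 *: J (Jinv (T n (u n))) by rewrite JinvK.
  have := phi_conv3 hsmooth q (ltW al1) (ltW al2) (ltW al3) halpha Jy'.
  have := ler_wpM2l (ltW al2) (zs q n Bq).
  have := ler_wpM2l (ltW al3) (le_trans (lerD Tq (lexx _)) (us q n Bq)).
  have : (alpha1 + alpha2 + alpha3) * phi q (s n) = phi q (s n).
    by rewrite halpha mul1r.
  lra.

(* The shrinking sets and convergence of the iterates *)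
have CnP n : [/\ closed (Cn n), midconvex (Cn n), B `<=` Cn n & Cn n `<=` C].
  elim: n => [|n [cC mC BC CC]].
    rewrite hC0; split=> //; first exact: convex_set_midconvex.
    by move=> q; rewrite hB => -[[+ _] _]; rewrite -hFJ => /(_ 0%N I)[].
  rewrite hCn; split.
  - exact: closed_phi_le.
  - exact: midconvex_phi_le.
  - move=> q Bq; split; first exact: BC.
    rewrite -subr_ge0; apply: le_trans (key q n Bq).
    by rewrite addr_ge0// mulr_ge0 ?phi_ge0// ltW.
  - by move=> v [/CC].
have [q0 Bq0] := B0.
have xmin n : Cn n (x n) /\ forall v, Cn n v -> phi (x n) (x 0%N) <= phi v (x 0%N).
  have [cC mC BC _] := CnP n.
  (* At index 0 there is no projection: minimality holds because phi(x 0, x 0) = 0 is the least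
     possible value. *)
  case: n cC mC BC => [_ _ _|n cC mC BC].
    by rewrite hC0; split=> // v _; rewrite phi_xx// phi_ge0.
  by rewrite hx; apply: gen_projP => //; exists q0; exact: BC.
have Cndecr n m : (n <= m)%N -> Cn m `<=` Cn n.
  move=> /subnK <-; elim: (m - n)%N => [//|k IH].
  by rewrite addSn hCn => v [/IH].
(* This is phi(x n, x 0) up to the constant [|x 0|^2], in the form to which [gap_energy] applies. *)
pose F n := energy (J (x 0%N)) (x n).
have Fmin n v : Cn n v -> F n <= energy (J (x 0%N)) v.
  by move=> /(xmin n).2; rewrite !phi_energy lerD2r.
have Fnd : nondecreasing_seq F.
  by move=> n m nm; apply: Fmin; apply: (Cndecr _ _ nm); exact: (xmin m).1.
have Fub n : F n <= energy (J (x 0%N)) q0.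
  by apply: Fmin; have [_ _ BC _] := CnP n; exact: BC.
have Fcvg : cvgn F.
  apply: nondecreasing_is_cvgn => //.
  by exists (energy (J (x 0%N)) q0) => _ [n _ <-].
have [M HM] := energy_bounded (J (x 0%N)) (energy (J (x 0%N)) q0).
have xM n : `|x n| <= M by apply: HM; exact: Fub.
have xcvg : cvgn x.
  (* For n <= m the midpoint of x n and x m lies in [Cn n], so its energy is at least F n. The gap
     is then at most (F m - F n)/2, hence at most the remaining increase of F. *)
  apply: (gap_cauchy (eps := fun n => limn F - F n) hconvex xM).
    by rewrite -(subrr (limn F)); apply: cvgB => //; exact: cvg_cst.
  move=> n m nm; rewrite (gap_energy (J (x 0%N))) -!/(F _).
  have [_ mC _ _] := CnP n.
  have := Fmin n _ (mC _ _ (xmin n).1 (Cndecr _ _ nm _ (xmin m).1)).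
  have := nondecreasing_cvgn_le Fnd Fcvg m; have := Fnd _ _ nm; lra.
pose p := limn x.
have xp : x @ \oo --> p by exact: xcvg.
have Cx n : C (x n) by have [_ _ _] := CnP n; apply; exact: (xmin n).1.
have Cp : C p by apply: (closed_cvg C Cclosed _ _ xp); exact: nearW.
have hxp : h (x n) @[n --> \oo] --> h p.
  apply: (@cvg_from_dist0 _ _ _ (fun=> h p)); first exact: cvg_cst.
  have lim : rho%:num * `|x n - p| @[n --> \oo] --> (0 : R).
    rewrite -(mulr0 rho%:num); apply: cvgM; first exact: cvg_cst.
    by apply: cvg_dist0; first exact: xp; exact: cvg_cst.
  apply: (squeeze_cvgr _ (cvg_cst 0) lim); apply: nearW => n.
  by rewrite normr_ge0/=; exact: (hh.2 (x n, p) (conj (Cx n) Cp)).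

(* Convergence of the auxiliary sequences *)
have Jxp := cvg_J hsmooth xp; have Jhp := cvg_J hsmooth hxp.
have sp : s @ \oo --> p.
  apply: cvg_J_inv => //.
  have -> : (fun n => J (s n)) = (fun n => lambda n *: J (h (x n))
      + sigma n *: J ubar + (1 - lambda n - sigma n) *: J (x n)).
    by apply/funext => n; rewrite hs JinvK.
  have -> : J p = 0 *: J (h p) + 0 *: J ubar + (1 - 0 - 0) *: J p.
    by rewrite !scale0r !add0r !subr0 scale1r.
  apply: cvgD; last first.
    by apply: cvgZ => //; apply: cvgB => //; apply: cvgB => //; exact: cvg_cst.
  by apply: cvgD; apply: cvgZ => //; exact: cvg_cst.
have xSp : x n.+1 @[n --> \oo] --> p by rewrite cvg_shiftS.
have xy0 : `|x n.+1 - y n| @[n --> \oo] --> (0 : R).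
  apply: (phi_cvg0_l hsmooth hconvex (M := M)) => //.
  have lim := cvg_phi hsmooth xSp sp; rewrite phi_xx// in lim.
  apply: (squeeze_cvgr _ (cvg_cst 0) lim); apply: nearW => n.
  by rewrite phi_ge0//=; have := (xmin n.+1).1; rewrite hCn => -[].
have yx0 : `|y n - x n.+1| @[n --> \oo] --> (0 : R).
  by under eq_fun do rewrite distrC.
have yp : y @ \oo --> p by exact: cvg_from_dist0 xSp yx0.
have gap0 : phi q0 (s n) - phi q0 (y n) @[n --> \oo] --> (0 : R).
  rewrite -(subrr (phi q0 p)).
  by apply: cvgB; apply: cvg_phi => //; exact: cvg_cst.
have [sM HsM] : exists M, forall n, `|s n| <= M.
  have /cvg_seq_bounded : cvg (s @ \oo) by apply/cvg_ex; exists p.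
  move=> [M1 [_ HM1]]; exists (M1 + 1) => n.
  by apply: HM1 => //; rewrite ltrDl.
(* Common to z and u: each satisfies this bound after the other nonnegative term of [key] is
   dropped. *)
have resol (al : R) (w : nat -> E) : 0 < al ->
    (forall n, al * phi (w n) (s n) <= phi q0 (s n) - phi q0 (y n)) ->
    `|w n - s n| @[n --> \oo] --> (0 : R).
  move=> al0 H; apply: (phi_cvg0_r hsmooth hconvex HsM).
  have lim : al^-1 * (phi q0 (s n) - phi q0 (y n)) @[n --> \oo] --> (0 : R).
    by rewrite -(mulr0 al^-1); apply: cvgM => //; exact: cvg_cst.
  apply: (squeeze_cvgr _ (cvg_cst 0) lim); apply: nearW => n.
  by rewrite phi_ge0//= ler_pdivlMl.
have zs0 : `|z n - s n| @[n --> \oo] --> (0 : R).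
  apply: (resol alpha2) => // n; apply: le_trans (key q0 n Bq0).
  by rewrite lerDl mulr_ge0 ?phi_ge0// ltW.
have us0 : `|u n - s n| @[n --> \oo] --> (0 : R).
  apply: (resol alpha3) => // n; apply: le_trans (key q0 n Bq0).
  by rewrite lerDr mulr_ge0 ?phi_ge0// ltW.
have zp := cvg_from_dist0 sp zs0; have up := cvg_from_dist0 sp us0.
have Jsp := cvg_J hsmooth sp; have Jyp := cvg_J hsmooth yp.
have Jzp := cvg_J hsmooth zp; have Jup := cvg_J hsmooth up.
have Tup : T n (u n) @[n --> \oo] --> J p.
  have -> : (fun n => T n (u n)) = (fun n => alpha3^-1 *:
      (J (y n) - alpha1 *: J (s n) - alpha2 *: J (z n))).
    apply/funext => n; rewrite Jy -addrA -opprD addrAC subrr add0r.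
    by rewrite scalerA mulVf ?scale1r// gt_eqF.
  have -> : J p = alpha3^-1 *: (J p - alpha1 *: J p - alpha2 *: J p).
    rewrite -[X in X - _ - _]scale1r -!scalerBl scalerA.
    have -> : 1 - alpha1 - alpha2 = alpha3 by lra.
    by rewrite mulVf ?scale1r// gt_eqF.
  apply: cvgZ; first exact: cvg_cst.
  by apply: cvgB; [apply: cvgB => //|]; apply: cvgZ => //; exact: cvg_cst.
have JT0 : `|J (u n) - T n (u n)| @[n --> \oo] --> (0 : R).
  exact: cvg_dist0 Jup Tup.

(* Identification of the limit *)
have Fp : FJ_family C Gamma p.
  move=> S GS; split=> //.
  (* The NST-condition passes the vanishing residual from T_n to S; applying Jinv then puts the
     sequence in the form required by [Jstar_closed]. *)
  have Sup : S (u n) @[n --> \oo] --> J p.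
    apply: cvg_from_dist0 Jup _; under eq_fun do rewrite distrC.
    by apply: hNST => //; apply: cvg_seq_bounded; apply/cvg_ex; exists p.
  have JiS : Jinv (S (u n)) @[n --> \oo] --> p.
    by apply: cvg_J_inv => //; under eq_fun do rewrite JinvK//.
  have JSp := (hGamma S GS).1 u p p Cu up JiS.
  by rewrite -[in RHS]JSp JinvK.
have Bp : B p.
  rewrite hB; split; first split=> //.
    move=> i _.
    exact: (EP_limit hsmooth Cclosed JCconvex (hf i) (hmu i) a0 hr zp sp Cz
      (fun n => (Hz n).2)).
  move=> j _.
  exact: (VI_limit hsmooth Cclosed (Acont j) (hnu j) a0 hr up sp Cu
    (fun n => (Hu n).2)).
(* B lies in every [Cn n], so F n is at most the energy of each q in B; the limit in n gives
   minimality of p over B. *)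
have -> : gen_proj B (x 0%N) = p.
  apply: gen_proj_eq => //; first exact: convex_set_midconvex.
  move=> q Bq; rewrite !phi_energy lerD2r.
  apply: (ler_cvg_to (cvg_energy (f := J (x 0%N)) xp) (cvg_cst _)).
  by apply: nearW => n; apply: Fmin; have [_ _ BC _] := CnP n; exact: BC.
by split; split => //; exact: cvg_dist0 sp xp.
Qed.
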